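(* Let $k \ge 2$ be an integer and let $\mathbf{n} = (n_1,\dots,n_k) \in \mathbb{Z}^k_{>0}$ be a counterexample to or a tight instance of the Lonely Runner Conjecture, i.e., $\operatorname{lon}(\mathbf{n}) \le \frac{1}{k+1}$. Then (a) $\mathbf{m} \cdot \mathbf{n} = 0$ for some $\mathbf{m} = (m_1,\dots,m_k) \in \mathbb{Z}^k$ with $0 < \|\mathbf{m}\|_1 \le 2k+3$ and $m_1 + \dots + m_k$ odd; and (b) $\mathbf{m} \cdot \mathbf{n} = 0$ for some $\mathbf{m} \in \mathbb{Z}^k$ with $0 < \|\mathbf{m}\|_1 \le \frac{k+1}{k-1}\operatorname{flt}(k)$.
   Context: For real $x$, $\|x\|_{\mathbb{Z}}$ denotes the distance from $x$ to the nearest integer. For $\mathbf{n} \in \mathbb{Z}^k_{>0}$ (a vector of $k$ positive integers), $\operatorname{lon}(\mathbf{n}) := \max_{t \in [0,1]} \min_{1 \le j \le k} \|t n_j\|_{\mathbb{Z}}$. The vector $\mathbf{n}$ is called a counterexample if $\operatorname{lon}(\mathbf{n}) < \frac{1}{k+1}$ and a tight instance if $\operatorname{lon}(\mathbf{n}) = \frac{1}{k+1}$. For $\mathbf{m} \in \mathbb{Z}^k$, $\|\mathbf{m}\|_1 := |m_1| + \dots + |m_k|$, and $\cdot$ is the standard dot product. The lattice width of a convex body $C \subset \mathbb{R}^k$ is $\operatorname{width}(C) := \min_{\mathbf{m} \in \mathbb{Z}^k \setminus \{\mathbf{0}\}} \max_{\mathbf{a},\mathbf{b} \in C} \mathbf{m}\cdot(\mathbf{a}-\mathbf{b})$.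 The body $C$ is hollow if it contains no integer points (points of $\mathbb{Z}^k$) in its interior. The flatness constant $\operatorname{flt}(k)$ is the minimal number such that every hollow convex body $C \subset \mathbb{R}^k$ has $\operatorname{width}(C) \le \operatorname{flt}(k)$; its existence (finiteness) is Khinchin's flatness theorem. *)

(* Defs.v *)
From HB Require Import structures.
From mathcomp Require Import all_boot all_order all_algebra.
From mathcomp Require Import all_classical all_reals all_analysis.

Set Implicit Arguments.
Unset Strict Implicit.
Unset Printing Implicit Defensive.

Import Order.TTheory GRing.Theory Num.Theory.
Import numFieldNormedType.Exports.

Local Open Scope classical_set_scope.
Local Open Scope ring_scope.

Definition dot (A : nzRingType) (k : nat) (u v : 'rV[A]_k) : A :=
  \sum_(j < k) u 0 j * v 0 j.

Definition norm1 (k : nat) (m : 'rV[int]_k) : int := \sum_(j < k) `|m 0 j|.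

Section LonelyRunner.
Variable R : realType.

Definition dist_int (x : R) : R := inf (range (fun z : int => `|x - z%:~R|)).

(* The default value 1 of the finite minimum exceeds every [dist_int]
   (these are at most 1/2), so it plays no role as soon as k > 0. *)
Definition loneliness (k : nat) (n : 'rV[int]_k) (t : R) : R :=
  \big[Num.min/1]_(j < k) dist_int (t * (n 0 j)%:~R).

(* The supremum is a maximum: [loneliness n] is continuous and [0, 1] is
   compact. *)
Definition lon (k : nat) (n : 'rV[int]_k) : R :=
  sup (loneliness n @` `[0, 1]).

End LonelyRunner.

Section Flatness.
Variables (R : realType) (k : nat).
Implicit Types (C : set 'rV[R]_k) (z m : 'rV[int]_k).

Definition to_real z : 'rV[R]_k := map_mx intr z.

Definition convex_body C : Prop :=
  [/\ convex_set C, compact C & interior C !=set0].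

Definition hollow C : Prop := forall z, ~ interior C (to_real z).

Definition width_along C m : R :=
  sup [set dot (to_real m) (p.1 - p.2) | p in C `*` C].

(* For a convex body both extrema are attained: the inner one by compactness,
   the outer one because a ball inside C makes [width_along C m] tend to
   infinity with m. *)
Definition width C : R := inf [set width_along C m | m in [set m | m != 0]].

Definition flatness_bound (c : R) : Prop :=
  forall C, convex_body C -> hollow C -> width C <= c.

(* Extended-real valued, so that the definition does not presuppose Khinchin's
   flatness theorem, which says that this infimum is not over the empty set. *)
Definition flt : \bar R := ereal_inf (EFin @` flatness_bound).

Lemma width_le_flt C : convex_body C -> hollow C -> ((width C)%:E <= flt)%E.
Proof.
move=> bodyC hollowC; apply: le_ereal_inf_tmp => _ [c bound_c <-].
by rewrite lee_fin; exact: bound_c.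
Qed.

Lemma flt_le c : flatness_bound c -> (flt <= c%:E)%E.
Proof. by move=> bound_c; apply: ereal_inf_lbound; exists c. Qed.

End Flatness.

(* Main.v *)
Require Import Defs.
From HB Require Import structures.
From mathcomp Require Import all_boot all_order all_algebra.
From mathcomp Require Import all_classical all_reals all_analysis.
From mathcomp Require Import ring lra zify.
Set Implicit Arguments.
Unset Strict Implicit.
Unset Printing Implicit Defensive.
Import Order.TTheory GRing.Theory Num.Theory.
Import numFieldNormedType.Exports.
Local Open Scope ring_scope.

(** Both halves start from the same reformulation of lon(n) <= 1/(k+1): at
every real time t some t n_j is within 1/(k+1) of an integer
([close_runner]).

Short odd relation.  This is a union bound for a tilted probability measure on
the times.  The plain union bound is too weak: under the uniform measure each
runner is within 1/(k+1) of the start with probability 2/(k+1), and k of these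
add up to more than 1.  Put phi_j = 2 pi t n_j + pi and choose a nonnegative
cosine polynomial g = p_0 + p_1 cos x + p_2 cos 2x + ... with nonnegative
coefficients which is small near pi, and weight the time t by
prod_j g(phi_j).  Expanding the product, the mean of prod_j cos(a_j phi_j) is
(-1)^(sum a_j) times the proportion of sign choices for which
sum_j +-a_j n_j = 0.  If there is no relation with odd coefficient sum and norm
at most L, all these means with sum a_j <= L are nonnegative
([sum_prod_phase_ge0]), so the mean of a product is monotone in the
coefficients ([le_sum_prod_cospoly]).  Replacing one factor g by its constant
term p_0 therefore gives E[prod_{i <> j} g(phi_i)] <= E[prod_i g(phi_i)] / p_0.
If g <= d wherever runner j is close to the start, the tilted probability that
runner j is close is at most d / p_0; as some runner is always close,
k d >= p_0 ([exists_odd_relation]).  It remains to exhibit g with k d < p_0 and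
k deg g <= 2k + 4 ([odd_relation]): the relation found has odd norm, hence
norm at most 2k + 3.  Runner j is close exactly when
cos phi_j <= - cos(2 pi/(k+1)), and for k >= 4 concavity of the cosine puts
this region inside -1 <= cos phi_j <= -1 + 4/(k+1); the square (cos x + b)^2
vanishing at the midpoint of that interval is small enough there.  For k = 2
and k = 3 the corresponding square misses the inequality k d < p_0, and
polynomials in cos x of degree 4 and 3 are used.  Averages are taken over the
times i/M with M large, where orthogonality of characters is an identity on
finite sums.

Flatness.  Thicken the segment {s n : |s| <= T} by the cube of half-side
r < (k-1)/(2(k+1)) centred at (1/2, ..., 1/2).  An integer point in this body
would be a time s at which every s n_j is farther than 1/(k+1) from the
integers, so the body is hollow ([tube_hollow]) and its width is at most
flt(k).  Directions m with m . n <> 0 see the long side, of length at least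
2T, and the others see width at least 2 r ||m||_1 ([width_tube_ge]).  For
large T the width is thus at least 2 r times the least norm of a relation; let
r tend to (k-1)/(2(k+1)). *)

(** * Distance to the integers and the cosine *)

Lemma nearest_int (R : realType) (x : R) :
  exists z : int, `|x - z%:~R| <= dist_int x.
Proof.
have [z hz] : exists z : int, forall y : int, `|x - z%:~R| <= `|x - y%:~R|.
  have /andP[f1 f2] := floor_itv x; rewrite intrD in f2.
  set f := Num.floor x in f1 f2.
  have away y : y%:~R <= f%:~R :> R \/ f%:~R + 1 <= y%:~R :> R.
    have [hy|hy] := lerP y f; first by left; rewrite ler_int.
    by right; rewrite -[1]/(1%:~R) -intrD ler_int; lia.
  have [h|h] := lerP (x - f%:~R) (1 / 2).
    exists f => y; rewrite (ger0_norm (_ : 0 <= x - f%:~R)); last lra.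
    by case: (away y) => ?; [rewrite ger0_norm | rewrite ler0_norm]; lra.
  exists (f + 1) => y; rewrite intrD ler0_norm; last lra.
  by case: (away y) => ?; [rewrite ger0_norm | rewrite ler0_norm]; lra.
exists z; apply: lb_le_inf; first by exists `|x - 0%:~R|, 0.
by move=> _ [y _ <-]; exact: hz.
Qed.

(** Times outside [0, 1] are covered because the n_j are integers: reducing t
modulo 1 moves each t n_j by an integer. *)
Lemma close_runner (R : realType) (k : nat) (n : 'rV[int]_k) (d : R) :
  d < 1 -> lon R n <= d ->
  forall t : R, exists j : 'I_k, exists z : int, `|t * (n 0 j)%:~R - z%:~R| <= d.
Proof.
move=> d1 lonn t.
pose u : R := t - (Num.floor t)%:~R.
have u01 : u \in `[0, 1].
  have /andP[f1 f2] := floor_itv t.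
  rewrite intrD in f2; rewrite in_itv /= /u; apply/andP; split; lra.
have lonu : loneliness n u <= d.
  apply: le_trans lonn; apply: ub_le_sup; last by exists u.
  exists 1 => _ [s _ <-]; rewrite /loneliness.
  exact: bigmin_le_id.
have [j hj] : exists j, dist_int (u * (n 0 j)%:~R) <= d.
  apply/not_existsP => h; move: lonu; rewrite leNgt => /negP; apply.
  rewrite /loneliness; elim/big_ind : _ => //.
    by move=> x y hx hy; rewrite lt_min hx.
  by move=> j _; rewrite ltNge; apply/negP; exact: h.
have [z hz] := nearest_int (u * (n 0 j)%:~R).
exists j, (z + Num.floor t * n 0 j).
apply: le_trans hj; apply: le_trans hz.
by rewrite intrD intrM /u le_eqVlt; apply/orP; left; apply/eqP; congr (`|_|); ring.
Qed.

Lemma cos_2piD_int (R : realType) (x : R) (z : int) :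
  cos (2 * pi * (x + z%:~R)) = cos (2 * pi * x).
Proof.
have nat_case (y : R) (p : nat) : cos (2 * pi * (y + p%:R)) = cos (2 * pi * y).
  rewrite mulrDr -[in RHS](periodicn (@cosD2pi R) p); congr cos.
  by rewrite -mulr_natr; ring.
case: z => p; first exact: nat_case.
by rewrite NegzE intrN -[LHS](nat_case _ p.+1); congr cos; rewrite subrK.
Qed.

Lemma cos_near_int (R : realType) (x d : R) (z : int) :
  d <= 1 / 2 -> `|x - z%:~R| <= d -> cos (2 * pi * d) <= cos (2 * pi * x).
Proof.
move=> d2 xd; have -> : x = x - z%:~R + z%:~R by rewrite subrK.
rewrite cos_2piD_int -[leRHS]cos_norm.
have pi0 := @pi_gt0 R.
rewrite normrM (ger0_norm (_ : 0 <= 2 * pi)); last lra.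
have := normr_ge0 (x - z%:~R) => x0.
rewrite leNgt ltr_cos ?in_itv /=; first by rewrite -leNgt ler_pM2l //; lra.
  by apply/andP; split; nra.
by apply/andP; split; nra.
Qed.

Lemma cos_2pi_eq1 (R : realType) (x : R) :
  cos (2 * pi * x) = 1 -> exists z : int, x = z%:~R.
Proof.
move=> cx; exists (Num.floor x); apply/eqP; rewrite -subr_eq0.
have /andP[f1 f2] := floor_itv x.
rewrite intrD in f2.
set y := x - _.
apply: contraT => y0.
have y_gt0 : 0 < y by rewrite lt_neqAle eq_sym y0 /= subr_ge0.
have : 0 < sin (pi * y).
  apply: sin_gt0_pi; have pi0 := @pi_gt0 R.
  by apply/andP; split; [exact: mulr_gt0 | rewrite /y; nra].
have : cos (2 * pi * y) = 1.
  by rewrite -[RHS]cx -[RHS](cos_2piD_int x (- Num.floor x)) intrN.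
have -> : 2 * pi * y = (pi * y) *+ 2 by rewrite -mulr_natr; ring.
rewrite cos_mulr2n cos2sin2 -mulr_natr => h1 h2; exfalso; nra.
Qed.

(** * Finite character sums *)

(** The real character t -> cos(2 pi b t) of the circle, sampled at t = i / M. *)
Definition wave (R : realType) (M : nat) (b : int) (i : nat) : R :=
  cos (2 * pi * (b%:~R * i%:R / M%:R)).

Lemma waveM (R : realType) (M : nat) (b c : int) (i : nat) :
  wave R M b i * wave R M c i = (wave R M (b + c) i + wave R M (b - c) i) / 2.
Proof.
rewrite /wave intrB intrD.
set x := 2 * pi * (b%:~R * _ / _); set y := 2 * pi * (c%:~R * _ / _).
have -> : 2 * pi * ((b%:~R + c%:~R) * i%:R / M%:R) = x + y by rewrite /x /y; ring.
have -> : 2 * pi * ((b%:~R - c%:~R) * i%:R / M%:R) = x - y by rewrite /x /y; ring.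
by rewrite cosD cosB; field.
Qed.

(** A sum over a period is invariant under i -> i + 1, and
wave b (i + 2) + wave b i = 2 cos(2 pi b / M) wave b (i + 1); so the sum S
satisfies 2 S = 2 cos(2 pi b / M) S, and vanishes unless M divides b. *)
Lemma sum_wave (R : realType) (M : nat) (b : int) : (0 < M)%N ->
  let S := \sum_(i < M) wave R M b i in
  0 <= S /\ (S != 0 -> (M%:Z %| b)%Z).
Proof.
case: M => // p _ S; set M := p.+1 in S *.
have MR : M%:R != 0 :> R by rewrite pnatr_eq0.
have [/cos_2pi_eq1[z /(canRL (mulfVK MR)) bz]|b1] :=
  eqVneq (cos (2 * pi * (b%:~R / M%:R)) : R) 1.
  have {}bz : b = z * M%:Z by apply/eqP; rewrite -(eqr_int R) intrM bz.
  split=> [|_]; last by rewrite bz dvdz_mull.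
  apply: sumr_ge0 => i _; rewrite /wave bz.
  have -> : (z * M%:Z)%:~R * (i : nat)%:R / M%:R = 0 + (z * i%:Z)%:~R :> R.
    by rewrite !intrM; field.
  by rewrite cos_2piD_int mulr0 cos0.
suff S0 : S = 0 by rewrite S0 eqxx.
pose f (i : nat) : R := wave R M b i.
have fper i : f (i + M)%N = f i.
  rewrite /f /wave -[RHS](cos_2piD_int _ b) natrD; congr cos; by field.
have shift m : \sum_(i < M) f (i + m)%N = S.
  elim: m => [|m IHm]; first by apply: eq_bigr => i _; rewrite addn0.
  rewrite -IHm big_ord_recr [in RHS]big_ord_recl /= addrC; congr (_ + _).
    by rewrite -[RHS]fper addnS -addSn addnC.
  by apply: eq_bigr => i _; rewrite /bump /= !addnS add1n.
clearbody S.
have : S + S = 2 * cos (2 * pi * (b%:~R / M%:R)) * S.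
  rewrite -[in RHS](shift 1%N) mulr_sumr -{1}(shift 2%N) -(shift 0%N).
  rewrite -big_split; apply: eq_bigr => i _ /=.
  rewrite /f /wave addn0.
  set x := 2 * pi * (b%:~R / M%:R).
  set y := 2 * pi * (b%:~R * (i + 1)%:R / M%:R).
  have -> : 2 * pi * (b%:~R * (i + 2)%:R / M%:R) = y + x.
    by rewrite /x /y !natrD; field.
  have -> : 2 * pi * (b%:~R * (i : nat)%:R / M%:R) = y - x.
    by rewrite /x /y !natrD; field.
  by rewrite cosD cosB; ring.
move=> e; apply/eqP; move/eqP: e; rewrite -subr_eq0.
have -> : S + S - 2 * cos (2 * pi * (b%:~R / M%:R)) * S =
   2 * (1 - cos (2 * pi * (b%:~R / M%:R))) * S by ring.
rewrite !mulf_eq0 pnatr_eq0 /= subr_eq0 eq_sym.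
by rewrite (negbTE b1).
Qed.

(** Each factor splits by cos u cos v = (cos(u + v) + cos(u - v)) / 2, so the
product is an average of waves whose frequencies are b plus or minus each
[y j]; the extra factor of frequency b carries the induction. *)
Lemma sum_wave_prod (R : realType) (M k : nat) (y : 'I_k -> int) (b : int) :
  (0 < M)%N ->
  let S := \sum_(i < M) wave R M b i * \prod_(j < k) wave R M (y j) i in
  0 <= S /\
  (S != 0 -> exists e : 'I_k -> bool,
     (M%:Z %| b + \sum_(j < k) (-1) ^+ e j * y j)%Z).
Proof.
move=> M0; elim: k y b => [|k IHk] y b.
  have -> : \sum_(i < M) wave R M b i * \prod_(j < 0) wave R M (y j) i =
            \sum_(i < M) wave R M b i.
    by apply: eq_bigr => i _; rewrite big_ord0 mulr1.
  have [h0 h1] := sum_wave R b M0.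
  by split=> // /h1 h; exists (fun _ => false); rewrite big_ord0 addr0.
pose y' (j : 'I_k) := y (lift ord0 j).
pose T c := \sum_(i < M) wave R M c i * \prod_(j < k) wave R M (y' j) i.
have -> : \sum_(i < M) wave R M b i * \prod_(j < k.+1) wave R M (y j) i =
          (T (b + y ord0) + T (b - y ord0)) / 2.
  rewrite -big_split /= mulr_suml; apply: eq_bigr => i _.
  by rewrite big_ord_recl mulrA waveM; ring.
have [p0 pd] := IHk y' (b + y ord0); have [q0 qd] := IHk y' (b - y ord0).
have ext (e0 : bool) : (exists e : 'I_k -> bool,
     (M%:Z %| b + (-1) ^+ e0 * y ord0 + \sum_(j < k) (-1) ^+ e j * y' j)%Z) ->
  exists e : 'I_k.+1 -> bool,
     (M%:Z %| b + \sum_(j < k.+1) (-1) ^+ e j * y j)%Z.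
  move=> [e he]; exists (fun j => if unlift ord0 j is Some j' then e j' else e0).
  rewrite big_ord_recl unlift_none addrA.
  by under eq_bigr => j _ do rewrite liftK.
split; first by apply: divr_ge0 => //; apply: addr_ge0.
have [-> | /pd h _] := eqVneq (T (b + y ord0)) 0; last first.
  by apply: (ext false); rewrite expr0 mul1r.
rewrite add0r mulf_eq0 negb_or => /andP[/qd h _].
by apply: (ext true); rewrite expr1 mulN1r.
Qed.

(** * Positivity in the absence of odd relations *)

Lemma odd_norm1 (k : nat) (m : 'rV[int]_k) :
  odd `|norm1 m|%N = odd `|(\sum_(j < k) m 0 j)%R|%N.
Proof.
have h : (2 %| norm1 m - \sum_(j < k) m 0 j)%Z.
  rewrite -sumrB; apply: rpred_sum => j _.
  suff -> : `|m 0 j| - m 0 j = (if m 0 j < 0 then - m 0 j else 0) * 2.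
    exact: dvdz_mull.
  have [h|h] := ltrP (m 0 j) 0; first by rewrite ltr0_norm //; lia.
  by rewrite ger0_norm //; lia.
lia.
Qed.

(** The half-turn shift [+ pi] is what detects parity: it multiplies
cos(a x) by (-1)^a ([cos_mul_phase]). *)
Definition phase (R : realType) (k M : nat) (n : 'rV[int]_k) (i : nat) (j : 'I_k) : R :=
  2 * pi * (i%:R / M%:R * (n 0 j)%:~R) + pi.

Lemma cos_mul_phase (R : realType) (k M : nat) (n : 'rV[int]_k) (i a : nat) (j : 'I_k) :
  cos (a%:R * phase R M n i j) = (-1) ^+ a * wave R M (a%:Z * n 0 j) i.
Proof.
rewrite /phase /wave intrM.
have -> : a%:R * (2 * pi * (i%:R / M%:R * (n 0 j)%:~R) + pi) =
  2 * pi * (a%:R * (n 0 j)%:~R * i%:R / M%:R) + pi *+ a :> R.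
  by rewrite -mulr_natr; ring.
by rewrite (alternatingn (@cosDpi R)).
Qed.

Section OddRelation.
Variables (R : realType) (k : nat) (n : 'rV[int]_k) (L : nat).
Hypothesis no_odd_relation : forall m : 'rV[int]_k,
  norm1 m <= L%:Z -> odd `|(\sum_(j < k) m 0 j)%R|%N -> dot m n != 0.

(* More sample times than the size of sum_j +-a_j n_j whenever sum a_j <= L. *)
Let M := (L * \sum_(j < k) absz (n 0%R j)).+1.

(** If sum a_j is even the shift is harmless and the sum is a nonnegative
combination of character sums.  If it is odd, a nonzero sum would give signs
with sum_j +-a_j n_j divisible by M, hence zero as M exceeds its size: an odd
relation of norm sum a_j. *)
Lemma sum_prod_phase_ge0 (a : 'I_k -> nat) : (\sum_(j < k) a j <= L)%N ->
  0 <= \sum_(i < M) \prod_(j < k) cos ((a j)%:R * phase R M n i j).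
Proof.
move=> aL.
pose S : R := \sum_(i < M) wave R M 0 i * \prod_(j < k) wave R M ((a j)%:Z * n 0 j) i.
have -> : \sum_(i < M) \prod_(j < k) cos ((a j)%:R * phase R M n i j) =
          (-1) ^+ (\sum_(j < k) a j)%N * S.
  rewrite /S mulr_sumr; apply: eq_bigr => i _.
  rewrite [wave R M 0 i]/wave !mul0r mulr0 cos0 mul1r.
  under eq_bigr do rewrite cos_mul_phase.
  by rewrite big_split /= prodrXr.
have [S0 Sdvd] := sum_wave_prod R (fun j => (a j)%:Z * n 0 j) 0 (ltn0Sn _ : (0 < M)%N).
have [even_a|odd_a] := boolP (odd (\sum_(j < k) a j)); last first.
  by rewrite -signr_odd (negbTE odd_a) mul1r.
suff -> : S = 0 by rewrite mulr0.
apply/eqP; apply: contraT => /Sdvd[e]; rewrite add0r.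
pose m : 'rV[int]_k := \row_j ((-1) ^+ e j * (a j)%:Z).
have norm_m : norm1 m = (\sum_(j < k) a j)%N%:Z.
  rewrite -[RHS]natz natr_sum; apply: eq_bigr => j _.
  by rewrite mxE normrM normr_sign mul1r natz.
have -> : \sum_(j < k) (-1) ^+ e j * ((a j)%:Z * n 0 j) = dot m n.
  by apply: eq_bigr => j _; rewrite mxE mulrA.
move=> dvd_m.
have := no_odd_relation (m := m).
rewrite -odd_norm1 norm_m => /(_ aL even_a).
apply: contraNT => _.
have : (`|dot m n| < M)%N.
  rewrite ltnS (leq_trans (n := \sum_(j < k) (a j * absz (n 0%R j)))) //.
    rewrite -lez_nat abszE; apply: le_trans (ler_norm_sum _ _ _) _.
    rewrite -[leRHS]natz natr_sum; apply: ler_sum => j _.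
    by rewrite mxE -mulrA normrMsign normrM natz PoszM abszE.
  rewrite big_distrr; apply: leq_sum => j _; rewrite leq_mul2r.
  by rewrite (leq_trans _ aL) ?orbT // (bigD1 j) //= leq_addr.
have [-> //|dot0] := eqVneq (dot m n) 0.
by move: dvd_m => /[swap] lt_M; rewrite dvdzE gtnNdvd // absz_gt0.
Qed.

(** Expand both products into monomials and compare coefficients: every
monomial has nonnegative sum by [sum_prod_phase_ge0]. *)
Lemma le_sum_prod_cospoly (d : nat) (G G' : 'I_k -> 'I_d.+1 -> R) :
  (k * d <= L)%N -> (forall j a, 0 <= G' j a <= G j a) ->
  \sum_(i < M) \prod_(j < k) \sum_(a < d.+1) G' j a * cos (a%:R * phase R M n i j) <=
  \sum_(i < M) \prod_(j < k) \sum_(a < d.+1) G j a * cos (a%:R * phase R M n i j).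
Proof.
move=> kdL G'G.
have expand (H : 'I_k -> 'I_d.+1 -> R) :
  \sum_(i < M) \prod_(j < k) \sum_(a < d.+1) H j a * cos (a%:R * phase R M n i j) =
  \sum_(f : {ffun 'I_k -> 'I_d.+1}) (\prod_(j < k) H j (f j)) *
    \sum_(i < M) \prod_(j < k) cos ((f j)%:R * phase R M n i j).
  under eq_bigr do rewrite bigA_distr_bigA.
  rewrite exchange_big; apply: eq_bigr => f _.
  by rewrite mulr_sumr; apply: eq_bigr => i _; rewrite big_split.
rewrite !expand; apply: ler_sum => f _; apply: ler_wpM2r.
  apply: sum_prod_phase_ge0; apply: leq_trans kdL.
  rewrite -[X in (_ <= X * _)%N]card_ord -sum_nat_const.
  by apply: leq_sum => j _; rewrite -ltnS.
by apply: ler_prod => j _; exact: G'G.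
Qed.

End OddRelation.

(** * The tilted union bound *)

Definition cospoly (R : realType) (p : seq R) (x : R) : R :=
  \sum_(a < size p) p`_a * cos (a%:R * x).

(** The union bound for the measure with density prod_j g(phi_j), with
denominators cleared: [E] is the total mass, and the product [E' j] omitting
the factor j satisfies p_0 E' j <= E, while E <= d * sum_j E' j because some
factor is at most d at each time. *)
Lemma exists_odd_relation (R : realType) (k : nat) (n : 'rV[int]_k) (L : nat)
    (p : seq R) (c d : R) :
  (0 < size p)%N -> (k * (size p).-1 <= L)%N ->
  (forall a, 0 <= p`_a) -> (forall x, 0 <= cospoly p x) ->
  (forall x, cos x <= - c -> cospoly p x <= d) -> k%:R * d < p`_0 ->
  (forall t : R, exists j, c <= cos (2 * pi * (t * (n 0 j)%:~R))) ->
  exists m : 'rV[int]_k,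
    [/\ norm1 m <= L%:Z, odd `|(\sum_(j < k) m 0 j)%R|%N & dot m n = 0].
Proof.
case: p => // p0 p _ /= kpL p_ge0 pos_p le_p_d kd near.
set g := cospoly (p0 :: p) in pos_p le_p_d.
apply: contrapT => no_rel.
have no_odd (m : 'rV[int]_k) : norm1 m <= L%:Z ->
    odd `|(\sum_(j < k) m 0 j)%R|%N -> dot m n != 0.
  by move=> mL mo; apply/eqP => m0; apply: no_rel; exists m.
set M := (L * \sum_(j < k) absz (n 0%R j)).+1.
pose ph := phase R M n.
have le_mean := le_sum_prod_cospoly no_odd kpL.
pose G (_ : 'I_k) (a : 'I_(size p).+1) := (p0 :: p)`_a.
pose E := \sum_(i < M) \prod_(j < k) g (ph i j).
pose E' j0 := \sum_(i < M) \prod_(j < k | j != j0) g (ph i j).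
have single x : p0 = \sum_(a < (size p).+1)
    (if a == 0 :> nat then p0 else 0) * cos (a%:R * x).
  rewrite big_ord_recl /= mul0r cos0 mulr1 big1 ?addr0 // => a _.
  by rewrite mul0r.
have p0_ge0 : 0 <= p0 := p_ge0 0%N.
have coef_le (j : 'I_k) (a : 'I_(size p).+1) :
  0 <= (if a == 0 :> nat then p0 else 0) <= G j a.
  by rewrite /G; case: ifP => [/eqP -> | _]; rewrite ?lexx ?p0_ge0 ?p_ge0.
have E_le j0 : p0 * E' j0 <= E.
  pose G' (j : 'I_k) (a : 'I_(size p).+1) :=
    if j == j0 then (if a == 0 :> nat then p0 else 0) else G j a.
  have G'G j a : 0 <= G' j a <= G j a.
    by rewrite /G'; case: ifP => _; [exact: coef_le | rewrite lexx p_ge0].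
  apply: le_trans (le_mean R G G' G'G).
  rewrite mulr_sumr; apply: ler_sum => i _.
  rewrite [leRHS](bigD1 j0) //= /G' eqxx -single ler_wpM2l //.
  rewrite le_eqVlt; apply/orP; left; apply/eqP; apply: eq_bigr => j /negbTE jj0.
  by rewrite jj0.
(* Replacing every factor by its constant term bounds E below by M p0^k. *)
have E_gt0 : 0 < p0 -> 0 < E.
  move=> p0_gt0; apply: lt_le_trans (le_mean R G _ coef_le).
  apply: (lt_le_trans (y := \sum_(i < M) p0 ^+ k)).
    by rewrite sumr_const card_ord pmulrn_lgt0 // exprn_gt0.
  apply: ler_sum => i _; rewrite -[k in _ ^+ k]card_ord -prodr_const.
  by rewrite le_eqVlt; apply/orP; left; apply/eqP; apply: eq_bigr => j _.
have near_half i : exists j : 'I_k, cos (ph i j) <= - c.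
  have [j hj] := near (i%:R / M%:R); exists j.
  by rewrite /ph /phase cosDpi lerN2.
(* A time at which some factor lies in [0, d] exists, so d >= 0; this in turn
   makes the constant term p0 > k d positive. *)
have d_ge0 : 0 <= d.
  have [j hj] := near_half 0%N.
  exact: le_trans (pos_p _) (le_p_d _ hj).
have {}E_gt0 : 0 < E.
  by apply: E_gt0; apply: le_lt_trans kd; rewrite mulr_ge0.
have : E <= d * \sum_(j < k) E' j.
  rewrite exchange_big mulr_sumr; apply: ler_sum => i _ /=.
  have [j0 hj0] := near_half i.
  rewrite (bigD1 j0) //= [leRHS](_ : _ = d *
    (\prod_(j < k | j != j0) g (ph i j) +
     \sum_(j1 < k | j1 != j0) \prod_(j < k | j != j1) g (ph i j))); last first.
    by rewrite [in LHS](bigD1 j0).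
  rewrite mulrDr; apply: ler_wpDr.
    by rewrite mulr_ge0 // sumr_ge0 // => j _; apply: prodr_ge0.
  by rewrite ler_wpM2r ?le_p_d // prodr_ge0.
rewrite leNgt => /negP; apply.
have : p0 * (d * \sum_(j < k) E' j) <= d * (k%:R * E).
  rewrite mulrCA ler_wpM2l // mulr_sumr.
  rewrite mulr_natl -[X in _ *+ X]card_ord -sumr_const; exact: ler_sum.
nra.
Qed.

(** * Kernels *)

Lemma cosMS2 (R : realType) (x : R) (a : nat) :
  cos (a.+2%:R * x) = 2 * cos x * cos (a.+1%:R * x) - cos (a%:R * x).
Proof.
have -> : a.+2%:R * x = a.+1%:R * x + x by rewrite -[in LHS]addn1 natrD; ring.
have -> : a%:R * x = a.+1%:R * x - x by rewrite -[in RHS]addn1 natrD; ring.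
by rewrite cosD cosB; ring.
Qed.

(** Concavity of the cosine on [0, pi/2], in the form of two mean value
estimates: the slope on [0, x] is - sin u, the slope on [x, pi/2] is - sin v,
and u < v. *)
Lemma cos_ge_chord (R : realType) (x : R) :
  0 <= x <= pi / 2 -> 1 - 2 * x / pi <= cos x.
Proof.
move=> /andP[x0 x1]; have pi0 := @pi_gt0 R.
have [->|x_neq0] := eqVneq x 0; first by rewrite mulr0 mul0r cos0 subr0.
have [->|x_neq1] := eqVneq x (pi / 2).
  by rewrite cos_pihalf (_ : 1 - _ = 0) //; field; lra.
have {x_neq0}x0 : 0 < x by rewrite lt_neqAle eq_sym x_neq0.
have {x_neq1}x1 : x < pi / 2 by rewrite lt_neqAle x_neq1.
have slope (a b : R) : a < b -> exists2 c, c \in `]a, b[ & cos b - cos a = - sin c * (b - a).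
  by move=> ab; apply: MVT => // c; apply: continuous_subspaceT => y; exact: continuous_cos.
have [u] := slope _ _ x0; rewrite in_itv /= cos0 subr0 => /andP[u0 u1] eu.
have [v] := slope _ _ x1; rewrite in_itv /= cos_pihalf sub0r => /andP[v0 v1] ev.
have uv : sin u <= sin v by rewrite ltW // ltr_sin ?in_itv /=; first lra; apply/andP; split; lra.
rewrite -subr_ge0.
suff : 0 <= cos x * (pi / 2) - (pi / 2 - x).
  rewrite (_ : cos x - _ = (cos x * (pi / 2) - (pi / 2 - x)) / (pi / 2)); last by field; lra.
  by move=> h; apply: divr_ge0 => //; lra.
have e1 : 1 - cos x = sin u * x by lra.
have e2 : cos x = sin v * (pi / 2 - x) by lra.
have : sin u * (x * (pi / 2 - x)) <= sin v * (x * (pi / 2 - x)).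
  by apply: ler_wpM2r => //; nra.
nra.
Qed.

(** With c the cosine, cos 3x = 1 reads 4 c^3 - 3 c - 1 = (c - 1) (2 c + 1)^2 = 0. *)
Lemma cos_2pi3 (R : realType) : cos (2 * pi * (1 / 3)) = - (1 / 2) :> R.
Proof.
have pi0 := @pi_gt0 R.
set x : R := 2 * pi * (1 / 3).
have : cos (3%:R * x) = 1.
  have -> : 3%:R * x = 0 + pi *+ 2 by rewrite /x -mulr_natr; field.
  by rewrite cosD2pi cos0.
have : cos x < 1.
  rewrite -[ltRHS]cos0 ltr_cos ?in_itv /= ?lexx ?pi_ge0 //; first by rewrite /x; lra.
  by rewrite /x; apply/andP; split; lra.
rewrite !cosMS2 (mul1r x) (mul0r x) cos0; set c := cos x => c1 e.
have : (c - 1) * (c + 1 / 2) ^+ 2 = 0 by lra.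
move/eqP; rewrite mulf_eq0 sqrf_eq0 => /orP[/eqP|/eqP]; lra.
Qed.

Section Kernels.
Variable R : realType.

(** The left side is (5 + 2 (4 cos x + 3 cos 2x + 2 cos 3x + cos 4x)) / 16, a
multiple of the Fejer kernel of order 5. *)
Lemma kernel2E (x : R) :
  cospoly [:: 5 / 16; 1 / 2; 3 / 8; 1 / 4; 1 / 8] x =
  (cos x ^+ 2 + cos x / 2 - 1 / 4) ^+ 2.
Proof.
rewrite /cospoly !big_ord_recl big_ord0 /= /bump /=.
by rewrite !cosMS2 (mul1r x) (mul0r x) cos0; field.
Qed.

Lemma kernel3E (x : R) :
  cospoly [:: 5 / 4; 2; 1; 1 / 4] x =
  (1 + cos x) * (cos x + 1 / 2) ^+ 2.
Proof.
rewrite /cospoly !big_ord_recl big_ord0 /= /bump /=.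
by rewrite !cosMS2 (mul1r x) (mul0r x) cos0; field.
Qed.

Lemma kernel_quadE (b x : R) :
  cospoly [:: b ^+ 2 + 1 / 2; 2 * b; 1 / 2] x = (cos x + b) ^+ 2.
Proof.
rewrite /cospoly !big_ord_recl big_ord0 /= /bump /=.
by rewrite !cosMS2 (mul1r x) (mul0r x) cos0; field.
Qed.
End Kernels.

(** * The short odd relation *)

Lemma odd_relation (R : realType) (k : nat) (n : 'rV[int]_k) :
  (2 <= k)%N -> lon R n <= 1 / (k%:R + 1) ->
  exists m : 'rV[int]_k,
    [/\ dot m n = 0, 0 < norm1 m, norm1 m <= (2 * k + 3)%N%:Z
      & odd `|(\sum_(j < k) m 0 j)%R|%N].
Proof.
move=> k2 lon_n; set N : R := k%:R + 1 in lon_n.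
have kR : 2 <= k%:R :> R by rewrite ler_nat.
have N3 : 3 <= N by rewrite /N; lra.
have N_inv : 1 / N <= 1 / 2 by rewrite ler_pdivrMr; lra.
have near (t : R) : exists j, cos (2 * pi * (1 / N)) <= cos (2 * pi * (t * (n 0 j)%:~R)).
  have [j [z hz]] := close_runner (ltac:(lra) : 1 / N < 1) lon_n t.
  by exists j; exact: cos_near_int hz.
suff [m [mL m_odd m_n]] : exists m : 'rV[int]_k,
    [/\ norm1 m <= (2 * k + 4)%N%:Z, odd `|(\sum_(j < k) m 0 j)%R|%N & dot m n = 0].
  have norm_ge0 : 0 <= norm1 m by apply: sumr_ge0 => j _.
  by exists m; split=> //; move: m_odd mL norm_ge0; rewrite -odd_norm1; lia.
have seq_ge0 (p : seq R) : all (fun a => 0 <= a) p -> forall a, 0 <= p`_a.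
  move=> /allP p0 a; have [ap|ap] := ltnP a (size p); last by rewrite nth_default.
  by apply: p0; exact: mem_nth.
have [k2'|k3] := eqVneq k 2%N.
  (* On -1 <= c <= 1/2 the square root c^2 + c/2 - 1/4 of the kernel ranges over
     [-5/16, 1/4], hence the value 25/256. *)
  apply: (exists_odd_relation (R := R) (p := [:: 5 / 16; 1 / 2; 3 / 8; 1 / 4; 1 / 8])
    (d := 25 / 256) _ _ _ _ _ _ near) => //=.
  - lia.
  - by apply: seq_ge0; rewrite /= !divr_ge0.
  - by move=> x; rewrite kernel2E sqr_ge0.
  - have -> : N = 3 by rewrite /N k2'; lra.
    move=> x; rewrite cos_2pi3 opprK kernel2E => cx; have cN1 := cos_geN1 x.
    set y := _ + _ - _.
    have yN : - (5 / 16) <= y by have := sqr_ge0 (cos x + 1 / 4); rewrite /y; nra.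
    have yP : y <= 1 / 4 by rewrite /y; nra.
    nra.
  - by rewrite k2'; lra.
have [k3'|k4] := eqVneq k 3%N.
  (* For -1 <= c <= 0 both 1 + c <= 1 and |c + 1/2| <= 1/2. *)
  apply: (exists_odd_relation (R := R) (p := [:: 5 / 4; 2; 1; 1 / 4])
    (d := 1 / 4) _ _ _ _ _ _ near) => //=.
  - lia.
  - by apply: seq_ge0; rewrite /= !divr_ge0 ?ler01 ?ler0n.
  - by move=> x; rewrite kernel3E mulr_ge0 ?sqr_ge0 //; have := cos_geN1 x; lra.
  - have -> : 2 * pi * (1 / N) = pi / 2 by rewrite /N k3'; field.
    move=> x; rewrite cos_pihalf oppr0 kernel3E => cx; have cN1 := cos_geN1 x.
    apply: (le_trans (y := (cos x + 1 / 2) ^+ 2)); last by nra.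
    by rewrite ler_piMl ?sqr_ge0 //; lra.
  - by rewrite k3'; lra.
have {}k4 : (4 <= k)%N by lia.
have k4R : 4 <= k%:R :> R by rewrite (ler_nat _ 4).
(* The cosines of close runners lie in [-1, -1 + 2 u]; the square is centred in
   that interval. *)
set u := 2 / N.
have u0 : 0 < u by apply: divr_gt0; rewrite // /N; lra.
have u1 : u <= 2 / 5 by rewrite ler_pdivrMr /N; lra.
have uk : u * (k%:R + 1) = 2 by rewrite /u -/N; field; lra.
apply: (exists_odd_relation (R := R) (p := [:: (1 - u) ^+ 2 + 1 / 2; 2 * (1 - u); 1 / 2])
  (d := u ^+ 2) _ _ _ _ _ _ near) => //=.
- lia.
- apply: seq_ge0; rewrite /= andbT; apply/and3P; split; nra.
- by move=> x; rewrite kernel_quadE sqr_ge0.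
- have : 1 - 2 * u <= cos (2 * pi * (1 / N)).
    have pi0 := @pi_gt0 R.
    apply: le_trans (cos_ge_chord _); last first.
      have -> : 2 * pi * (1 / N) = pi * u by rewrite /u; field; lra.
      by apply/andP; split; nra.
    rewrite le_eqVlt; apply/orP; left; apply/eqP; rewrite /u; field.
    by rewrite !gt_eqF //; lra.
  by move=> cu x cx; rewrite kernel_quadE; have := cos_geN1 x; nra.
- nra.
Qed.

(** * The flatness bound *)

Lemma norm1_gt0 (k : nat) (m : 'rV[int]_k) : (0 < norm1 m) = (m != 0).
Proof.
have norm_ge0 : 0 <= norm1 m by apply: sumr_ge0 => j _.
rewrite lt_def norm_ge0 andbT; congr negb; apply/eqP/eqP => [m0|->].
  apply/rowP => j; rewrite mxE; apply/eqP; rewrite -normr_eq0.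
  by apply/eqP/(psumr_eq0P _ m0) => // i _; exact: normr_ge0.
by rewrite /norm1 big1 // => j _; rewrite mxE normr0.
Qed.

Section Tube.
Local Open Scope classical_set_scope.
Variables (R : realType) (k : nat) (n : 'rV[int]_k) (r T : R).

Definition tube : set 'rV[R]_k :=
  [set x | exists2 s, - T <= s <= T &
    forall j, `|x 0 j - 1 / 2 - s * (n 0 j)%:~R| <= r].

Lemma tube_convex : convex_set tube.
Proof.
move=> x y t /[!inE] -[s /andP[s0 s1] xs] [u /andP[u0 u1] yu].
have [t0 t1] : 0 <= t%:num /\ t%:num <= 1 by split.
exists (t%:num * s + (1 - t%:num) * u); first by apply/andP; split; nra.
move=> j; have := xs j; have := yu j; rewrite !ler_norml /= => /andP[h1 h2] /andP[h3 h4].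
rewrite !mxE /=.
set a := x 0 j in h3 h4 *; set b := y 0 j in h1 h2 *; set c : R := (n 0 j)%:~R in h1 h2 h3 h4 *.
have -> : t%:num * a + (1 - t%:num) * b - 1 / 2 - (t%:num * s + (1 - t%:num) * u) * c =
  t%:num * (a - 1 / 2 - s * c) + (1 - t%:num) * (b - 1 / 2 - u * c) by ring.
by apply/andP; split; nra.
Qed.

Lemma tube_compact : compact tube.
Proof.
pose f (p : R * 'rV[R]_k) : 'rV[R]_k := p.2 + p.1 *: to_real R n.
pose Q : set 'rV[R]_k := [set y | forall j, `[1 / 2 - r, 1 / 2 + r]%classic (y 0 j)].
have -> : tube = f @` (`[- T, T] `*` Q).
  apply/seteqP; split=> [x [s sT xs]|_ [[s y] [/= sT yQ] <-]].
    exists (s, x - s *: to_real R n); last by rewrite /f /= subrK.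
    split=> [|j]; rewrite /= in_itv //=.
    by have := xs j; rewrite !mxE ler_norml => /andP[? ?]; apply/andP; split; lra.
  exists s; first by rewrite in_itv in sT.
  move=> j; have := yQ j; rewrite /= in_itv /= !mxE ler_norml => /andP[? ?].
  by rewrite /=; apply/andP; split; lra.
apply: continuous_compact.
  apply: continuous_subspaceT => p; apply: cvgD; first exact: cvg_snd.
  by apply: cvgZ; [exact: cvg_fst | exact: cvg_cst].
apply: compact_setX; first exact: segment_compact.
by apply: (rV_compact (A := fun=> `[1 / 2 - r, 1 / 2 + r]%classic)) => j; exact: segment_compact.
Qed.

Lemma tube_body : 0 < r -> 0 <= T -> convex_body tube.
Proof.
move=> r0 T0; split; [exact: tube_convex | exact: tube_compact |].
exists (const_mx (1 / 2)); apply/nbhs_ballP; exists r => //= x [_ hx].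
exists 0; first by rewrite oppr_le0 T0.
by move=> j; rewrite mul0r subr0 distrC ltW //; have := hx 0 j; rewrite mxE.
Qed.

(** Integer points are excluded from the closed body itself: at an integer
point z the time s would put every s n_j within r of z_j - 1/2, hence at
distance more than d from all integers. *)
Lemma tube_hollow (d : R) :
  (forall t : R, exists j : 'I_k, exists z : int, `|t * (n 0 j)%:~R - z%:~R| <= d) ->
  r + d < 1 / 2 -> hollow tube.
Proof.
move=> near rd z /interior_subset[s _ zs].
have [j [y hy]] := near s; have := zs j; move: hy.
rewrite mxE !ler_norml => /andP[y0 y1] /andP[z0 z1].
set w : R := s * _ in y0 y1 z0 z1.
have [yz|yz] := lerP (z 0 j) y.
  have : (z 0 j)%:~R <= y%:~R :> R by rewrite ler_int.
  lra.
have : (y + 1)%:~R <= (z 0 j)%:~R :> R by rewrite ler_int; lia.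
rewrite intrD; lra.
Qed.

Lemma width_along_ge (m : 'rV[int]_k) (p q : 'rV[R]_k) :
  tube p -> tube q -> dot (to_real R m) (p - q) <= width_along tube m.
Proof.
move=> tp tq; apply: ub_le_sup; last by exists (p, q).
exists (\sum_(j < k) `|(m 0 j)%:~R| * (2 * r + 2 * (T * `|(n 0 j)%:~R|))).
move=> _ [[x y] [/= [s sT xs] [u uT yu]] <-]; apply: ler_sum => j _ /=.
apply: le_trans (ler_norm _) _; rewrite normrM mxE ler_wpM2l ?normr_ge0 //.
have move_le (v : R) : - T <= v <= T -> `|v * (n 0 j)%:~R| <= T * `|(n 0 j)%:~R|.
  by rewrite -ler_norml normrM => vT; rewrite ler_wpM2r ?normr_ge0.
move: (move_le _ sT) (move_le _ uT) (xs j) (yu j).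
rewrite !mxE !ler_norml => /andP[? ?] /andP[? ?] /andP[? ?] /andP[? ?].
by apply/andP; split; lra.
Qed.

(** Attained between the opposite corners of the cube in the sign directions of
m. *)
Lemma width_along_ge_norm1 (m : 'rV[int]_k) : 0 <= r -> 0 <= T ->
  2 * r * (norm1 m)%:~R <= width_along tube m.
Proof.
move=> r0 T0.
pose p (e : R) : 'rV[R]_k := \row_j (1 / 2 + e * r * Num.sg (m 0 j)%:~R).
have tp e : `|e| <= 1 -> tube (p e).
  move=> e1; exists 0; first by rewrite oppr_le0 T0.
  move=> j; rewrite mxE mul0r subr0 [_ - _]addrC addKr !normrM (ger0_norm r0).
  rewrite -[leRHS]mul1r -[leRHS]mulr1 ler_pM ?mulr_ge0 ?ler_wpM2r //.
  by rewrite normr_sg lern1 leq_b1.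
apply: le_trans (width_along_ge m (tp 1 _) (tp (-1) _)); last 2 first.
- by rewrite normr1.
- by rewrite normrN1.
rewrite le_eqVlt; apply/orP; left; apply/eqP.
rewrite /norm1 rmorph_sum /= mulr_sumr; apply: eq_bigr => j _.
by rewrite !mxE intr_norm normrEsg; ring.
Qed.

(** Attained between the two ends of the segment, as |m . n| >= 1. *)
Lemma width_along_ge_dot (m : 'rV[int]_k) : 0 <= r -> 0 <= T ->
  dot m n != 0 -> 2 * T <= width_along tube m.
Proof.
move=> r0 T0 mn.
pose p (e : R) : 'rV[R]_k := \row_j (1 / 2 + e * (n 0 j)%:~R).
have tp e : `|e| <= T -> tube (p e).
  rewrite ler_norml => eT; exists e => // j.
  by rewrite mxE [_ - _]addrC addKr subrr normr0.
pose e : R := T * Num.sg (dot m n)%:~R.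
have eT : `|e| <= T.
  by rewrite normrM (ger0_norm T0) normr_sg intr_eq0 mn mulr1.
apply: le_trans (width_along_ge m (tp e eT) (tp (- e) _)); last by rewrite normrN.
have -> : dot (to_real R m) (p e - p (- e)) = 2 * (T * `|dot m n|%:~R).
  rewrite intr_norm normrEsg (mulrA T) -/e mulrA rmorph_sum /= mulr_sumr.
  by apply: eq_bigr => j _; rewrite !mxE intrM; ring.
by rewrite ler_pM2l // ler_peMr // ler1z -gtz0_ge1 normr_gt0.
Qed.

Lemma width_tube_ge (w : R) : (0 < k)%N -> 0 <= r -> 0 <= T -> w <= 2 * T ->
  (forall m, m != 0 -> dot m n = 0 -> w <= 2 * r * (norm1 m)%:~R) ->
  w <= width tube.
Proof.
move=> k0 r0 T0 wT wm.
apply: lb_le_inf.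
  exists (width_along tube (const_mx 1)), (const_mx 1) => //.
  apply/eqP => /rowP/(_ (Ordinal k0)); rewrite !mxE //.
move=> _ [m m0 <-]; have [mn|mn] := eqVneq (dot m n) 0.
  exact: le_trans (wm _ m0 mn) (width_along_ge_norm1 _ r0 T0).
exact: le_trans wT (width_along_ge_dot r0 T0 mn).
Qed.
End Tube.

Lemma exists_relation (k : nat) (n : 'rV[int]_k) :
  (2 <= k)%N -> (forall j, 0 < n 0 j) -> exists2 m : 'rV[int]_k, m != 0 & dot m n = 0.
Proof.
move=> k2 n_gt0; pose i0 := Ordinal (ltnW k2); pose i1 := Ordinal k2.
exists (n 0 i1 *: delta_mx 0 i0 - n 0 i0 *: delta_mx 0 i1).
  apply/eqP => /rowP/(_ i0); rewrite !mxE !eqxx /= !mulr0 subr0 mulr1 => n0.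
  by have := n_gt0 i1; rewrite n0 ltxx.
rewrite /dot (bigD1 i0) //= (bigD1 i1) //= big1 => [|j /andP[/negbTE j0 /negbTE j1]].
  by rewrite !mxE !eqxx /=; ring.
by rewrite !mxE !eqxx j0 j1 /= !mulr0 subr0 mul0r.
Qed.

(** The norm is an integer, so there is a relation m of least norm N; with
T = r N both kinds of direction give width at least 2 r N.  Hence
2 r N <= flt(k) for all r < r0, where 2 r0 = (k-1)/(k+1). *)
Lemma flatness_relation (R : realType) (k : nat) (n : 'rV[int]_k) :
  (2 <= k)%N -> (forall j, 0 < n 0 j) -> lon R n <= 1 / (k%:R + 1) ->
  exists m : 'rV[int]_k,
    [/\ dot m n = 0, 0 < norm1 m
      & (((norm1 m)%:~R)%:E <= ((k%:R + 1) / (k%:R - 1))%:E * flt R k)%E].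
Proof.
move=> k2 n_gt0 lon_n.
have kR : 2 <= k%:R :> R by rewrite (ler_nat _ 2).
have [m [m0 mn m_min]] : exists m : 'rV[int]_k, [/\ m != 0, dot m n = 0 &
    forall m', m' != 0 -> dot m' n = 0 -> norm1 m <= norm1 m'].
  pose P N := `[< exists m : 'rV[int]_k, [/\ m != 0, dot m n = 0 & norm1 m = N%:Z] >].
  have norm_nat (m : 'rV[int]_k) : norm1 m = `|norm1 m|%N%:Z.
    by rewrite gez0_abs //; apply: sumr_ge0 => j _.
  have exP : exists N, P N.
    have [m m0 mn] := exists_relation k2 n_gt0.
    by exists `|norm1 m|%N; apply/asboolP; exists m.
  have [N /asboolP[m [m0 mn mN]] N_min] := ex_minnP exP.
  exists m; split=> // m' m'0 m'n; rewrite mN (norm_nat m') lez_nat.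
  by apply: N_min; apply/asboolP; exists m'.
exists m; split; rewrite ?norm1_gt0 //.
set N : R := (norm1 m)%:~R.
have N_gt0 : 0 < N by rewrite ltr0z norm1_gt0.
pose r0 : R := (k%:R - 1) / (2 * (k%:R + 1)).
have r0_gt0 : 0 < r0 by apply: divr_gt0; lra.
have r0E : r0 + 1 / (k%:R + 1) = 1 / 2 by rewrite /r0; field; lra.
have N_le (r : R) : 0 < r < r0 -> ((2 * r * N)%:E <= flt R k)%E.
  move=> /andP[r_gt0 r_lt].
  have T_ge0 : 0 <= r * N by rewrite mulr_ge0 ?ltW.
  apply: le_trans (width_le_flt (tube_body n r_gt0 T_ge0) _); last first.
    apply: tube_hollow (close_runner _ lon_n) _; last lra.
    by rewrite ltr_pdivrMr; lra.
  rewrite lee_fin; apply: width_tube_ge => //; try lra.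
    exact: ltnW.
  move=> m' m'0 m'n; rewrite ler_wpM2l ?ler_int ?m_min //; lra.
have NE : N = (k%:R + 1) / (k%:R - 1) * (2 * r0 * N) by rewrite /r0; field; lra.
have factor_gt0 : 0 < (k%:R + 1) / (k%:R - 1) :> R by apply: divr_gt0; lra.
rewrite [in leLHS]NE EFinM lee_pmul2l //.
case: (flt R k) N_le => [f| |] N_le; last 2 first.
- by rewrite leey.
- by have := N_le (r0 / 2); rewrite leeNy_eq; apply; lra.
rewrite lee_fin leNgt; apply/negP => f_lt.
have f_ge : r0 * N <= f.
  have := N_le (r0 / 2); rewrite lee_fin => h.
  by rewrite -[r0 * N](_ : 2 * (r0 / 2) * N = _); [apply: h; lra | field].
(* A radius strictly between f / (2 N) and r0 violates [N_le]. *)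
pose r := (f / (2 * N) + r0) / 2.
have rN : 2 * r * N = (f + 2 * r0 * N) / 2 by rewrite /r; field; lra.
have := N_le r; rewrite lee_fin rN => h.
have : (f + 2 * r0 * N) / 2 <= f.
  apply: h; have f_pos : 0 < f / (2 * N) by apply: divr_gt0; nra.
  have : f / (2 * N) < r0 by rewrite ltr_pdivrMr; nra.
  by move=> ?; rewrite /r; apply/andP; split; lra.
lra.
Qed.

Theorem theorem1p1 (R : realType) (k : nat) (n : 'rV[int]_k)
    (k_ge2 : (2 <= k)%N)
    (n_gt0 : forall j : 'I_k, 0 < n 0 j)
    (lon_n : lon R n <= 1 / (k%:R + 1)) :
  (exists m : 'rV[int]_k,
     [/\ dot m n = 0,
         0 < norm1 m,
         norm1 m <= (2 * k + 3)%N%:Z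
       & odd `|(\sum_(j < k) m 0 j)%R|%N]) /\
  (exists m : 'rV[int]_k,
     [/\ dot m n = 0,
         0 < norm1 m
       & (((norm1 m)%:~R)%:E <= ((k%:R + 1) / (k%:R - 1))%:E * flt R k)%E]).
Proof.
by split; [exact: odd_relation lon_n | exact: flatness_relation lon_n].
Qed.
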